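(* Let $q$ be a prime power, let $k,T$ be integers with $0\le T<k$, let $n\ge 1$ be an integer with $\gcd(n,q)=1$, and let $\theta$ be the automorphism $\alpha\mapsto\alpha^{q^T}$ of $\mathbb{F}_{q^k}$. For every $q^k$-cyclotomic class $Q\subseteq \mathbb{Z}_n$, $$f_Q^{\ast,\theta}(x)=f_{-q^TQ}(x),$$ where $-q^TQ=\{-q^Ti \bmod n : i\in Q\}$. Consequently, $f_Q$ is $\theta$-self-reciprocal if and only if $Q=-q^TQ$, or equivalently, if and only if every element of $Q$ has additive order in $G_{(T,k)}(q,1)$.
   Context: The $q^k$-cyclotomic class of $i\in\mathbb{Z}_n$ is $\{q^{kj}i \bmod n: j\ge 0\}$. Fix a primitive $n$th root of unity $\zeta$ in an extension field of $\mathbb{F}_{q^k}$; for a $q^k$-cyclotomic class $Q\subseteq\mathbb{Z}_n$ let $f_Q(x)=\prod_{i\in Q}(x-\zeta^i)$, which is a monic irreducible factor of $x^n-1$ over $\mathbb{F}_{q^k}$. For $f(x)=f_0+f_1x+\cdots+f_mx^m\in\mathbb{F}_{q^k}[x]$ with $f_0,f_m\neq0$, the $\theta$-reciprocal is $f^{\ast,\theta}(x)=\theta(f_0)^{-1}x^m\theta\bigl(f(x^{-1})\bigr)$, where $\theta$ acts on coefficients. A monic polynomial $f$ with nonzero constant term is $\theta$-self-reciprocal if $f^{\ast,\theta}=f$. $G_{(T,k)}(q,1)$ denotes the set of positive integers $d$ such that $d\mid (q^{ks+T}+1)$ for some positive integer $s$. *)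

(* Defs.v *)
From HB Require Import structures.
From mathcomp Require Import all_boot all_order all_algebra all_fingroup.
From mathcomp Require Import all_solvable all_field.

Set Implicit Arguments.
Unset Strict Implicit.
Unset Printing Implicit Defensive.

Import GRing.Theory.
Local Open Scope ring_scope.

(* The ring Z/N with N >= 1 is represented by the additive group 'I_n.+1,   *)
(* with N = n.+1, so that the trivial case N = 1 is included; i *+ a is the *)
(* residue of a * i modulo N, and #[i]%g is the additive order of i.        *)

Definition prime_power (q : nat) : Prop :=
  exists p e : nat, [/\ prime p, (0 < e)%N & q = (p ^ e)%N].

Definition cyclotomic_class (r n : nat) (Q : {set 'I_n.+1}) : Prop :=
  exists i : 'I_n.+1,
    forall j : 'I_n.+1, j \in Q <-> exists s : nat, j = i *+ r ^ s.

Definition neg_scale (a n : nat) (Q : {set 'I_n.+1}) : {set 'I_n.+1} :=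
  [set - (i *+ a) | i in Q].

(* The coefficients of the product of the X - zeta^i are elements of L; each *)
(* one is pulled back along the embedding iota : F -> L. The default value 0 *)
(* is never used when Q is a #|F|-cyclotomic class: see map_class_poly.      *)
Definition class_poly (F : finFieldType) (L : fieldType)
    (iota : {rmorphism F -> L}) (n : nat) (zeta : L) (Q : {set 'I_n.+1}) :
    {poly F} :=
  map_poly (fun c : L => odflt 0 [pick a : F | iota a == c])
    (\prod_(i in Q) ('X - (zeta ^+ i)%:P)).

(* The monomial theta(f_i) X^-i of theta(f(X^-1)) times X^m, m = deg f, is  *)
(* theta(f_i) X^(m - i); the subtraction is exact since i <= m in the sum.  *)
Definition theta_reciprocal (F : fieldType) (theta : {rmorphism F -> F})
    (f : {poly F}) : {poly F} :=
  (theta f`_0)^-1 *: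
    \sum_(i < size f) theta f`_i *: 'X^((size f).-1 - i).

Definition theta_self_reciprocal (F : fieldType) (theta : {rmorphism F -> F})
    (f : {poly F}) : Prop :=
  [/\ f \is monic, f`_0 != 0 & theta_reciprocal theta f = f].

(* Membership in G_(T,k)(q,1). *)
Definition good_integer (T k q d : nat) : Prop :=
  (0 < d)%N /\ exists2 s : nat, (0 < s)%N & (d %| q ^ (k * s + T) + 1)%N.

Lemma cyclotomic_class_neg_scale (r a n : nat) (Q : {set 'I_n.+1}) :
  cyclotomic_class r Q -> cyclotomic_class r (neg_scale a Q).
Proof.
case=> i Qi; exists (- (i *+ a)) => j; split=> [/imsetP[x /Qi[s ->] ->] | [s ->]].
  by exists s; rewrite mulNrn mulrnAC.
apply/imsetP; exists (i *+ r ^ s); first by apply/Qi; exists s.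
by rewrite mulNrn mulrnAC.
Qed.

Lemma frobenius_pow (L : fieldType) (p e : nat) : p \in [pchar L] ->
  exists g : {rmorphism L -> L}, forall x, g x = x ^+ (p ^ e).
Proof.
move=> pL; elim: e => [|e [g gE]]; first by exists idfun => x; rewrite expr1.
exists (pFrobenius_aut pL \o g : {rmorphism L -> L}) => x /=.
by rewrite pFrobenius_autE gE -exprM -expnSr.
Qed.

Lemma fixed_in_image (F : finFieldType) (L : fieldType)
  (iota : {rmorphism F -> L}) (c : L) : c ^+ #|F| = c -> exists a, iota a = c.
Proof.
move=> cE; have := congr1 (fun P => (map_poly iota P).[c]) (finField_genPoly F).
rewrite /= rmorphB /= map_polyXn map_polyX !hornerE cE subrr.
rewrite rmorph_prod horner_prod /= => /esym/eqP/prodf_eq0[a _].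
rewrite map_polyXsubC hornerXsubC subr_eq0 => /eqP ->; by exists a.
Qed.

Lemma map_class_poly (F : finFieldType) (L : fieldType)
  (iota : {rmorphism F -> L}) (n : nat) (zeta : L) (Q : {set 'I_n.+1}) :
  n.+1.-primitive_root zeta -> coprime n.+1 #|F| -> cyclotomic_class #|F| Q ->
  map_poly iota (class_poly iota zeta Q) =
    \prod_(i in Q) ('X - (zeta ^+ i)%:P).
Proof.
move=> zP cop [i0 Qi0]; set P := \prod_(i in Q) _.
have fixP j : P`_j ^+ #|F| = P`_j.
  have [p p_pr pF] := finPcharP F.
  have [e cardF] : exists e, #|F| = (p ^ e)%N.
    by exists (logn p #|F|); rewrite -cardsT -card_pgroup //;
      apply: abelem_pgroup; apply: fin_ring_pchar_abelem.
  have pL : p \in [pchar L] by rewrite (fmorph_pchar iota).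
  have [g gE] := frobenius_pow e pL.
  have gP : map_poly g P = P.
    rewrite rmorph_prod /=.
    pose h (i : 'I_n.+1) := i *+ #|F|.
    have hK : cancel h (fun i => i *+ expg_invn [set: 'I_n.+1] #|F|).
      have copT : coprime #|[set: 'I_n.+1]%g| #|F| by rewrite cardsT card_ord.
      by move=> i; have := expgK copT (in_setT i); rewrite -!FinRing.zmodXgE.
    have hQ : h @: Q = Q.
      apply/eqP; rewrite eqEcard card_imset ?leqnn ?andbT; last exact: can_inj hK.
      apply/subsetP=> _ /imsetP[_ /Qi0[s ->] ->]; apply/Qi0; exists s.+1.
      by rewrite /h expnSr mulrnA.
    rewrite /P -[in RHS]hQ big_imset /=; last by move=> x y _ _; apply: (can_inj hK).
    apply: eq_bigr => i _; rewrite map_polyXsubC /= rmorphXn /= gE -cardF.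
    by rewrite /h Zp_mulrn /= (prim_expr_mod zP) exprAC exprM.
  by rewrite cardF -gE -coef_map gP.
rewrite /class_poly; apply/polyP=> j; rewrite coef_map coef_map_id0.
  case: pickP => [a /eqP // | no]; have [a aE] := fixed_in_image iota (fixP j).
  by have:= no a; rewrite aE eqxx.
case: pickP => [a /eqP|] //=; by rewrite -(rmorph0 iota) => /fmorph_inj.
Qed.

(* Main.v *)
Require Import Defs.
From HB Require Import structures.
From mathcomp Require Import all_boot all_order all_algebra all_fingroup.
From mathcomp Require Import all_solvable all_field.

Set Implicit Arguments.
Unset Strict Implicit.
Unset Printing Implicit Defensive.

Import GRing.Theory.
Local Open Scope ring_scope.

(** Over the extension [L], let [g] be the power map [x |-> x ^+ (q ^ T)]; as
    [q] is a power of the characteristic, it is a ring endomorphism, and it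
    restricts to [theta] on the embedded copy of [F].
    Taking the theta-reciprocal commutes with the embedding
    ([map_theta_reciprocal]), so it may be computed in [L], where the class
    polynomial splits.  There, reversing the coefficients turns each factor
    [X - a] into [1 - a X = - a (X - a^-1)], and the product of the scalars
    [- a] is the constant coefficient by which the reciprocal is normalized.
    Together with [g], the roots [a] are thus replaced by [(g a)^-1]
    ([theta_reciprocal_prod_XsubC]).  For [a = zeta ^+ i] the new root is
    [zeta ^+ (- (i *+ q ^ T))], and since [i |-> - (i *+ q ^ T)] is injective
    the outcome is the polynomial of [- q^T Q].

    As the powers of a primitive root are distinct, the polynomial of a class
    determines the class ([class_poly_inj]); this turns self-reciprocity into
    [Q = - q^T Q].  Finally [Q = - q^T Q] says that every [i] in [Q] is
    [- (i *+ q ^ (k * s + T))] for some [s], i.e. that the order of [i] divides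
    [q ^ (k * s + T) + 1].  Such an [s] can be taken positive, because
    multiplication by [q] is invertible modulo [n.+1], hence periodic
    ([neg_scale_fixed_good]). *)

(** * Reversal of polynomials *)

(** The degree bound [m] is kept separate from the size of [p], so that
    reversal at a fixed [m] is linear in [p]. *)
Definition reversal (R : nzRingType) (m : nat) (p : {poly R}) : {poly R} :=
  \sum_(i < m.+1) p`_i *: 'X^(m - i).

Lemma reversalMX (R : nzRingType) m (p : {poly R}) :
  reversal m.+1 (p * 'X) = reversal m p.
Proof.
rewrite /reversal big_ord_recl /= coefMX eqxx scale0r add0r.
by apply: eq_bigr => i _; rewrite /bump /= add1n coefMX /= subSS.
Qed.

Lemma reversalS (R : nzRingType) m (p : {poly R}) :
  (size p <= m.+1)%N -> reversal m.+1 p = reversal m p * 'X.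
Proof.
move=> sp; rewrite /reversal big_ord_recr /= nth_default // scale0r addr0.
rewrite mulr_suml; apply: eq_bigr => i _.
by rewrite -scalerAl -exprSr subSn // -ltnS.
Qed.

Lemma reversalM_XsubC (R : comNzRingType) m (p : {poly R}) a :
  (size p <= m.+1)%N ->
  reversal m.+1 (p * ('X - a%:P)) = reversal m p * (1 - a *: 'X).
Proof.
move=> sp; rewrite !mulrBr mulr1 -scalerAr -reversalS //.
rewrite -[in RHS](reversalMX m p) /reversal scaler_sumr -sumrB.
apply: eq_bigr => i _.
by rewrite coefB coefMC scalerBl scalerA (mulrC a).
Qed.

Lemma reversal_prod_XsubC (R : comNzRingType) (I : Type) (s : seq I)
    (a : I -> R) :
  reversal (size s) (\prod_(i <- s) ('X - (a i)%:P)) =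
    \prod_(i <- s) (1 - a i *: 'X).
Proof.
elim: s => [|i s IHs].
  by rewrite !big_nil /reversal big_ord1 coef1 scale1r expr0.
by rewrite !big_cons mulrC reversalM_XsubC ?size_prod_XsubC // IHs mulrC.
Qed.

(** * Theta-reciprocals of split polynomials *)

Lemma map_theta_reciprocal (F L : fieldType) (iota : {rmorphism F -> L})
    (theta : {rmorphism F -> F}) (g : {rmorphism L -> L}) (f : {poly F}) :
  (forall a, iota (theta a) = g (iota a)) ->
  map_poly iota (theta_reciprocal theta f) =
    theta_reciprocal g (map_poly iota f).
Proof.
move=> iotaE; rewrite /theta_reciprocal map_polyZ fmorphV iotaE coef_map.
rewrite size_map_poly rmorph_sum; congr (_ *: _); apply: eq_bigr => i _.
by rewrite /= map_polyZ map_polyXn iotaE coef_map.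
Qed.

(** Each reversed factor is [1 - (g a) X = - (g a) (X - (g a)^-1)], and the
    scalars [- g a] multiply to the image under [g] of the constant
    coefficient. *)
Lemma theta_reciprocal_prod_XsubC (L : fieldType) (g : {rmorphism L -> L})
    (I : Type) (s : seq I) (a : I -> L) :
  (forall i, a i != 0) ->
  theta_reciprocal g (\prod_(i <- s) ('X - (a i)%:P)) =
    \prod_(i <- s) ('X - (g (a i))^-1%:P).
Proof.
move=> a_neq0; set P := \prod_(i <- s) _.
have gP : map_poly g P = \prod_(i <- s) ('X - (g (a i))%:P).
  by rewrite rmorph_prod; apply: eq_bigr => i _; rewrite /= map_polyXsubC.
have sumE : \sum_(i < size P) g P`_i *: 'X^((size P).-1 - i) =
    reversal (size s) (map_poly g P).
  rewrite size_prod_XsubC /reversal.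
  by apply: eq_bigr => i _; rewrite coef_map.
have gP0 : g P`_0 = \prod_(i <- s) - g (a i).
  rewrite -coef_map gP -horner_coef0 horner_prod.
  by apply: eq_bigr => i _; rewrite hornerXsubC sub0r.
rewrite /theta_reciprocal sumE gP reversal_prod_XsubC gP0.
rewrite (eq_bigr (fun i => - g (a i) *: ('X - (g (a i))^-1%:P))); last first.
  move=> i _; have ga_neq0 : g (a i) != 0 by rewrite fmorph_eq0.
  rewrite scaleNr scalerBr -[_ *: _%:P]mul_polyC -polyCM divff //.
  by rewrite polyC1 opprB.
rewrite scaler_prod scalerA mulVf ?scale1r //.
rewrite prodf_seq_neq0 (eq_all (a2 := predT)) ?all_predT // => i.
by rewrite /= oppr_eq0 fmorph_eq0 a_neq0.
Qed.

(** * Powers of a primitive root indexed by residues *)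

Lemma prim_expr_neq0 (L : fieldType) (n : nat) (zeta : L) m :
  n.+1.-primitive_root zeta -> zeta ^+ m != 0.
Proof.
move=> zetaP; rewrite expf_neq0 //; apply: contra_eq_neq (prim_expr_order zetaP).
by move=> ->; rewrite expr0n eq_sym oner_eq0.
Qed.

Lemma prim_expr_mulrn (L : fieldType) (n : nat) (zeta : L) (i : 'I_n.+1) a :
  n.+1.-primitive_root zeta ->
  zeta ^+ (i *+ a)%R = (zeta ^+ i) ^+ a.
Proof. by move=> zetaP; rewrite Zp_mulrn /= (prim_expr_mod zetaP) exprM. Qed.

Lemma prim_expr_opp (L : fieldType) (n : nat) (zeta : L) (i : 'I_n.+1) :
  n.+1.-primitive_root zeta ->
  zeta ^+ (- i)%R = (zeta ^+ i)^-1.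
Proof.
move=> zetaP; have iN : (((- i)%R + i) %% n.+1 = 0)%N := congr1 val (addNr i).
apply: (mulIf (prim_expr_neq0 i zetaP)).
by rewrite mulVf ?(prim_expr_neq0 i zetaP) // -exprD -(prim_expr_mod zetaP) iN.
Qed.

Lemma prim_expr_inj (L : fieldType) (n : nat) (zeta : L) :
  n.+1.-primitive_root zeta ->
  injective (fun i : 'I_n.+1 => zeta ^+ i).
Proof.
move=> zetaP i j /eqP; rewrite (eq_prim_root_expr zetaP) !modn_small // => /eqP.
exact: val_inj.
Qed.

Lemma Zp_mulrn_inj n a : coprime n.+1 a ->
  injective (fun i : 'I_n.+1 => i *+ a).
Proof.
move=> cop; have copT : coprime #|[set: 'I_n.+1]%g| a by rewrite cardsT card_ord.
apply: (can_inj (g := fun i => i *+ expg_invn [set: 'I_n.+1] a)) => i.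
by have := expgK copT (in_setT i); rewrite -!FinRing.zmodXgE.
Qed.

(** * Cyclotomic classes and their polynomials *)

(** The residue [j] is recovered from the polynomial of its class: [zeta ^+ j]
    is a root exactly when [j] belongs to the class. *)
Lemma class_poly_inj (F : finFieldType) (L : fieldType)
    (iota : {rmorphism F -> L}) (n : nat) (zeta : L) (Q Q' : {set 'I_n.+1}) :
  n.+1.-primitive_root zeta -> coprime n.+1 #|F| ->
  cyclotomic_class #|F| Q -> cyclotomic_class #|F| Q' ->
  class_poly iota zeta Q = class_poly iota zeta Q' -> Q = Q'.
Proof.
move=> zetaP cop hQ hQ' /(congr1 (map_poly iota)).
rewrite !map_class_poly // => prodE.
have rootE (A : {set 'I_n.+1}) (j : 'I_n.+1) :
    root (\prod_(i in A) ('X - (zeta ^+ i)%:P)) (zeta ^+ j) = (j \in A).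
  rewrite /root horner_prod; apply/prodf_eq0/idP => [[i iA] | jA].
    by rewrite hornerXsubC subr_eq0 => /eqP/(prim_expr_inj zetaP) ->.
  by exists j; rewrite // hornerXsubC subrr.
by apply/setP => j; rewrite -!rootE prodE.
Qed.

(** In the forward direction the [s] that is read off the class may be 0; it is
    shifted by a period of multiplication by [q ^ k], which Euler's theorem
    provides.  Conversely the order condition puts [Q] inside [- q^T Q], which
    has at most as many elements. *)
Lemma neg_scale_fixed_good (q k T n : nat) (Q : {set 'I_n.+1}) :
  coprime n.+1 q -> cyclotomic_class (q ^ k) Q ->
  Q = neg_scale (q ^ T) Q <->
    (forall i : 'I_n.+1, i \in Q -> good_integer T k q #[i]%g).
Proof.
move=> cop [i0 Qi0].
have ordE (i : 'I_n.+1) s :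
    (#[i]%g %| q ^ (k * s + T) + 1)%N = (i == - (i *+ (q ^ k) ^ s *+ q ^ T)).
  rewrite order_dvdn FinRing.zmodXgE mulrnDr mulr1n expnD expnM mulrnA.
  by rewrite addrC -[1%g]/(0 : 'I_n.+1) addr_eq0.
split=> [QE i iQ | good].
  have [s iE] : exists s, i = - (i *+ (q ^ k) ^ s *+ q ^ T).
    have [s0 Ei] : exists s, i = i0 *+ (q ^ k) ^ s by apply/Qi0.
    have : i0 \in Q by apply/Qi0; exists 0%N.
    (* The generator is itself an image; multiply that relation by the power of
       q ^ k that takes i0 to i. *)
    rewrite {1}QE => /imsetP[_ /Qi0[s ->] i0E]; exists s.
    rewrite {1}Ei {1}i0E Ei mulNrn; congr (- _).
    by rewrite mulrnAC; congr (_ *+ _); apply: mulrnAC.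
  split; first exact: order_gt0.
  exists (s + totient n.+1)%N; first by rewrite addn_gt0 totient_gt0 orbT.
  have period : i *+ (q ^ k) ^ totient n.+1 = i.
    apply: val_inj; rewrite Zp_mulrn /= -modnMmr.
    rewrite Euler_exp_totient ?modnMmr ?muln1 ?modn_small //.
    by rewrite coprime_sym coprimeXr.
  by rewrite ordE addnC expnD mulrnA period -iE.
apply/eqP; rewrite eqEcard leq_imset_card andbT.
apply/subsetP => i iQ; have [_ [s _]] := good i iQ.
rewrite ordE => /eqP iE; apply/imsetP; exists (i *+ (q ^ k) ^ s) => //.
by have [t ->] := (Qi0 i).1 iQ; apply/Qi0; exists (t + s)%N; rewrite expnD mulrnA.
Qed.

Theorem theorem27 (q k T n : nat)
    (hq : prime_power q) (hT : (T < k)%N) (hn : coprime n.+1 q)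
    (F : finFieldType) (hF : #|F| = (q ^ k)%N)
    (theta : {rmorphism F -> F}) (htheta : forall a : F, theta a = a ^+ (q ^ T))
    (L : fieldType) (iota : {rmorphism F -> L})
    (zeta : L) (hzeta : n.+1.-primitive_root zeta)
    (Q : {set 'I_n.+1}) (hQ : cyclotomic_class (q ^ k) Q) :
  [/\ theta_reciprocal theta (class_poly iota zeta Q) =
        class_poly iota zeta (neg_scale (q ^ T) Q),
      theta_self_reciprocal theta (class_poly iota zeta Q) <->
        Q = neg_scale (q ^ T) Q
    & Q = neg_scale (q ^ T) Q <->
        (forall i : 'I_n.+1, i \in Q -> good_integer T k q #[i]%g)].
Proof.
have copF : coprime n.+1 #|F| by rewrite hF coprimeXr.
have hQF : cyclotomic_class #|F| Q by rewrite hF.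
have hQF' := cyclotomic_class_neg_scale (q ^ T) hQF.
have [g gE] : exists g : {rmorphism L -> L}, forall x, g x = x ^+ (q ^ T).
  have [p [e [p_pr _ qE]]] := hq.
  have pF : p \in [pchar F].
    by apply: (card_finPcharP (n := e * k)) p_pr; rewrite hF qE expnM.
  have pL : p \in [pchar L] by rewrite (fmorph_pchar iota).
  by rewrite qE -expnM; apply: frobenius_pow.
have recE : theta_reciprocal theta (class_poly iota zeta Q) =
    class_poly iota zeta (neg_scale (q ^ T) Q).
  apply: (map_poly_inj iota); rewrite (map_theta_reciprocal (g := g)); last first.
    by move=> a; rewrite htheta rmorphXn gE.
  rewrite !map_class_poly // -!big_enum theta_reciprocal_prod_XsubC; last first.
    by move=> i; apply: prim_expr_neq0 hzeta.
  rewrite !big_enum big_imset /=; last first.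
    by move=> i j _ _ /oppr_inj/Zp_mulrn_inj -> //; apply: coprimeXr.
  by apply: eq_bigr => i _; rewrite prim_expr_opp // prim_expr_mulrn // gE.
split=> //; last exact: neg_scale_fixed_good.
split=> [[_ _ selfQ] | QE].
  by apply: (class_poly_inj (iota := iota) hzeta copF hQF hQF'); rewrite -recE selfQ.
split; last by rewrite recE -QE.
  by rewrite -(map_monic iota) map_class_poly // monic_prod_XsubC.
rewrite -(fmorph_eq0 iota) -coef_map map_class_poly // -horner_coef0 horner_prod.
apply/prodf_neq0 => i _.
by rewrite hornerXsubC sub0r oppr_eq0 (prim_expr_neq0 _ hzeta).
Qed.
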